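(* Let $(H,\circ_H,\Delta_H)$ be a vector space over $K$ together with a pre-Lie product $\circ_H$ and a connected non-associative permutative coproduct $\Delta_H$ satisfying, for all $a,b\in H$, $$\Delta_H(a\circ_H b)=a\otimes b+\Delta_H(a)\circ_H b .$$ Then there is an isomorphism, which is simultaneously one of pre-Lie algebras and of non-associative permutative coalgebras, between $H$ and $(\mathcal{RT}(\mathrm{Prim}\,H),\circ,\Delta)$.
   Context: $K$ is a field of characteristic $0$; vector spaces are over $K$. A (right) pre-Lie algebra is a vector space $L$ with a bilinear product $\circ$ such that $(x\circ y)\circ z-x\circ(y\circ z)=(x\circ z)\circ y-x\circ(z\circ y)$ for all $x,y,z$. For such $L$ and $y\in L$, define the action on $L^{\otimes n}$ by $(x_1\otimes\cdots\otimes x_n)\circ y=\sum_{i=1}^n x_1\otimes\cdots\otimes (x_i\circ y)\otimes\cdots\otimes x_n$; this is the meaning of $\Delta_H(a)\circ_H b$. A non-associative permutative coalgebra is a vector space $C$ with a linear map $\Delta:C\to C\otimes C$ such that $(\mathrm{Id}-\tau_{23})(\Delta\otimes \mathrm{Id})\Delta=0$, where $\tau_{23}$ exchanges the last two factors of $C^{\otimes 3}$. Given $(C,\Delta)$, put $\mathrm{Prim}\,C=C_1=\{x\in C\mid\Delta(x)=0\}$ and, for $n\ge2$, $C_n=\{x\in C\mid \Delta(x)\in\sum_{i=1}^{n-1}C_i\otimes C_{n-i}\}$. $(C,\Delta)$ is connected if $C=\bigcup_{n\ge1}C_n$. A rooted tree is a nonempty finite connected graph without loops (cycles) with a distinguished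 vertex, the root. $\mathrm{Vert}(T)$ is the vertex set of $T$. $\mathcal{RT}(n)$ is the vector space spanned by rooted trees with vertices labeled bijectively by $\{1,\dots,n\}$, with the right action of the symmetric group $\Sigma_n$ on labels. For a vector space $V$, $\mathcal{RT}(V)=\bigoplus_{n\ge1}\mathcal{RT}(n)\otimes_{\Sigma_n}V^{\otimes n}$; if $V$ has basis $\{e_\alpha\}$, then $\mathcal{RT}(V)$ has as basis the rooted trees with vertices labeled by elements of $\{e_\alpha\}$. $B(v,T_1,\dots,T_n)$ denotes the tree whose root is labeled $v$ and whose (unordered) branches attached to the root are $T_1,\dots,T_n$. The pre-Lie product on $\mathcal{RT}(V)$ is $S\circ T=\sum_{v\in \mathrm{Vert}(S)}S\circ_vT$, where $S\circ_v T$ is obtained by grafting the root of $T$ on the vertex $v$ of $S$ (by a new edge). The coproduct on $\mathcal{RT}(V)$ is $\Delta(B(v,T_1,\dots,T_n))=\sum_{i=1}^nB(v,T_1,\dots,\widehat{T_i},\dots,T_n)\otimes T_i$ (the hat meaning omission). *)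

(* Defs.v *)
From HB Require Import structures.
From mathcomp Require Import all_boot all_order all_algebra.
From mathcomp Require Import generic_quotient ring_quotient sesquilinear.
From mathcomp Require Import zify boolp.
From mathcomp.multinomials Require Import freeg.

Set Implicit Arguments.
Unset Strict Implicit.
Unset Printing Implicit Defensive.

Import GRing.Theory.
Local Open Scope ring_scope.
Local Open Scope quotient_scope.

Section Span.
Variables (K : fieldType) (M : lmodType K).
Implicit Types (S : M -> Prop) (x y : M).

Inductive lspan S : M -> Prop :=
| lspan0 : lspan S 0
| lspanP a x y : S x -> lspan S y -> lspan S (a *: x + y).

Definition lspan_pred S : {pred M} := fun x => `[< lspan S x >].

Lemma lspan_incl S x : S x -> lspan S x.
Proof.
move=> Sx; rewrite -[x]scale1r -[_ *: _]addr0.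
by apply: lspanP => //; constructor.
Qed.

Lemma lspanD S x y : lspan S x -> lspan S y -> lspan S (x + y).
Proof.
move=> + Sy; elim=> [|a u v Su _ Sv]; first by rewrite add0r.
by rewrite -addrA; constructor.
Qed.

Lemma lspanZ S a x : lspan S x -> lspan S (a *: x).
Proof.
elim=> [|b u v Su _ Sv]; first by rewrite scaler0; constructor.
by rewrite scalerDr scalerA; constructor.
Qed.

Lemma lspan_zmod_closed S : zmod_closed (lspan_pred S).
Proof.
split=> [|x y /asboolP Sx /asboolP Sy]; apply/asboolP; first by constructor.
by apply: lspanD => //; rewrite -scaleN1r; apply: lspanZ.
Qed.

HB.instance Definition _ S :=
  GRing.isZmodClosed.Build M (lspan_pred S) (lspan_zmod_closed S).

End Span.

Section QuotMod.
Variables (K : fieldType) (M : lmodType K) (S : M -> Prop).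

Definition quotmod : Type := Quotient.quot (lspan_pred S : zmodClosed M).

HB.instance Definition _ := GRing.Zmodule.on quotmod.

Definition qpi (x : M) : quotmod := \pi_(Quotient.quot (lspan_pred S)) x.

Lemma qpiP x y : qpi x = qpi y <-> lspan S (x - y).
Proof.
split=> [/eqP|Sxy]; last apply/eqP; rewrite -Quotient.idealrBE.
- by move/asboolP.
- exact/asboolP.
Qed.

Definition qrep (x : quotmod) : M := repr (x : Quotient.quot (lspan_pred S)).

Lemma qrepK : cancel qrep qpi.
Proof. by move=> x; rewrite /qpi /qrep reprK. Qed.

Lemma qpiD : {morph qpi : x y / x + y}.
Proof. by move=> x y; rewrite /qpi /= !piE. Qed.

Definition qscale (a : K) (x : quotmod) : quotmod := qpi (a *: qrep x).

Lemma qscale_pi a x : qscale a (qpi x) = qpi (a *: x).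
Proof. by apply/qpiP; rewrite -scalerBr; apply/lspanZ/qpiP/qrepK. Qed.

Lemma qscaleA a b x : qscale a (qscale b x) = qscale (a * b) x.
Proof. by rewrite -(qrepK x) !qscale_pi scalerA. Qed.

Lemma qscale1 x : qscale 1 x = x.
Proof. by rewrite -(qrepK x) !qscale_pi scale1r. Qed.

Lemma qscaleDr a x y : qscale a (x + y) = qscale a x + qscale a y.
Proof.
by rewrite -(qrepK x) -(qrepK y) -qpiD !qscale_pi -qpiD scalerDr.
Qed.

Lemma qscaleDl x a b : qscale (a + b) x = qscale a x + qscale b x.
Proof. by rewrite -(qrepK x) !qscale_pi -qpiD scalerDl. Qed.

HB.instance Definition _ := GRing.Zmodule_isLmodule.Build K quotmod
  qscaleA qscale1 qscaleDr qscaleDl.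

Lemma qpi_linear : linear qpi.
Proof. by move=> a x y; rewrite qpiD -qscale_pi. Qed.

HB.instance Definition _ :=
  GRing.isLinear.Build K M quotmod *:%R qpi qpi_linear.

Lemma qpi_rel x : S x -> qpi x = 0.
Proof.
move=> Sx; rewrite -(raddf0 qpi); apply/qpiP.
by rewrite subr0; apply: lspan_incl.
Qed.

Section Lift.
Variables (N : lmodType K) (f : {linear M -> N}).
Hypothesis f_rel : forall x, S x -> f x = 0.

Definition qlift of (forall x, S x -> f x = 0) := fun x : quotmod => f (qrep x).

Lemma lspan_ker x : lspan S x -> f x = 0.
Proof.
elim=> [|a y z Sy _ fz0]; first exact: raddf0.
by rewrite linearP f_rel // fz0 scaler0 addr0.
Qed.

Lemma qlift_pi x : qlift f_rel (qpi x) = f x.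
Proof.
by apply/eqP; rewrite -subr_eq0 -raddfB; apply/eqP/lspan_ker/qpiP/qrepK.
Qed.

Lemma qlift_linear : linear (qlift f_rel).
Proof.
move=> a x y; rewrite -(qrepK x) -(qrepK y) -linearP.
by rewrite !qlift_pi linearP.
Qed.

HB.instance Definition _ :=
  GRing.isLinear.Build K quotmod N *:%R (qlift f_rel) qlift_linear.

End Lift.

End QuotMod.

Section FreeModule.
Variables (K : fieldType) (X : choiceType).

Definition freemod : Type := {freeg X / K}.

HB.instance Definition _ := GRing.Lmodule.copy freemod {freeg X / K}.

Definition fgen (x : X) : freemod := << x >>.

Variables (N : lmodType K) (g : X -> N).

Definition flift (D : freemod) : N := fglift g D.

Lemma flift_zmod_morphism : zmod_morphism flift.
Proof. exact: lift_is_additive. Qed.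

HB.instance Definition _ :=
  GRing.isZmodMorphism.Build freemod N flift flift_zmod_morphism.

Lemma flift_scalable : scalable flift.
Proof.
move=> a x.
have -> : a *: x = \sum_(z <- dom x) (<< a * coeff z x *g z >> : freemod) by [].
have -> : flift x = flift (\sum_(z <- dom x) (<< coeff z x *g z >> : freemod)).
  by congr flift; rewrite -[LHS]freeg_sumE.
rewrite !raddf_sum; apply: eq_bigr => z _.
by rewrite [LHS]liftU -scalerA; congr (_ *: _); rewrite [RHS]liftU.
Qed.

HB.instance Definition _ :=
  GRing.isScalable.Build K freemod N *:%R flift flift_scalable.

Lemma flift_gen x : flift (fgen x) = g x.
Proof. by rewrite /flift liftU scale1r. Qed.

Lemma freemodE (D : freemod) : D = \sum_(x <- dom D) coeff x D *: fgen x.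
Proof.
rewrite -[LHS]freeg_sumE; apply: eq_bigr => x _.
by apply/eqP/freeg_eqP => y; rewrite coeffZ !coeffU mul1r.
Qed.

Lemma freemod_ext (f h : {linear freemod -> N}) :
  (forall x, f (fgen x) = h (fgen x)) -> f =1 h.
Proof.
move=> fh D; rewrite (freemodE D) !linear_sum; apply: eq_bigr => x _.
by rewrite !linearZ_LR fh.
Qed.

End FreeModule.

Section FreeModuleTheory.
Variables (K : fieldType) (X : choiceType) (N : lmodType K).
Implicit Types (g h : X -> N) (D : freemod K X).

Lemma fliftE g D : flift g D = \sum_(x <- dom D) coeff x D *: g x.
Proof.
rewrite {1}(freemodE D) linear_sum; apply: eq_bigr => x _.
by rewrite linearZ_LR /= flift_gen.
Qed.

Lemma eq_flift g h D : g =1 h -> flift g D = flift h D.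
Proof. by move=> gh; rewrite !fliftE; apply: eq_bigr => x _; rewrite gh. Qed.

Lemma fliftP a g h D :
  flift (fun x => a *: g x + h x) D = a *: flift g D + flift h D.
Proof.
rewrite !fliftE scaler_sumr -big_split; apply: eq_bigr => x _ /=.
by rewrite scalerDr !scalerA mulrC.
Qed.

Lemma fliftD g h D : flift (fun x => g x + h x) D = flift g D + flift h D.
Proof.
rewrite -[flift g D]scale1r -fliftP.
by apply: eq_flift => x; rewrite scale1r.
Qed.

Lemma flift_sum (I : Type) (r : seq I) (g : I -> X -> N) D :
  flift (fun x => \sum_(i <- r) g i x) D = \sum_(i <- r) flift (g i) D.
Proof.
rewrite fliftE; under eq_bigr do rewrite scaler_sumr.
by rewrite exchange_big /=; under [RHS]eq_bigr do rewrite fliftE.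
Qed.

Lemma freemod_ind (P : freemod K X -> Prop) :
  P 0 -> (forall a x D, P D -> P (a *: fgen K x + D)) -> forall D, P D.
Proof.
move=> P0 PD D; rewrite (freemodE D).
by elim: (dom D) => [|x s IH]; rewrite ?big_nil // big_cons; apply: PD.
Qed.

End FreeModuleTheory.

Lemma flift_comp (K : fieldType) (X : choiceType) (N M : lmodType K)
    (f : {linear N -> M}) (g : X -> N) (D : freemod K X) :
  flift (fun x => f (g x)) D = f (flift g D).
Proof.
elim/freemod_ind: D => [|a x D IH]; first by rewrite !linear0.
by rewrite !linearP /= !flift_gen IH.
Qed.

Section Tensor.
Variables (K : fieldType) (V W : lmodType K).

Local Notation gen v w := (fgen K (v, w)).

Inductive tensor_rel : freemod K (V * W)%type -> Prop :=
| tensor_rell a v v' w :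
    tensor_rel (gen (a *: v + v') w - (a *: gen v w + gen v' w))
| tensor_relr a v w w' :
    tensor_rel (gen v (a *: w + w') - (a *: gen v w + gen v w')).

Definition tensor : Type := quotmod tensor_rel.

HB.instance Definition _ := GRing.Lmodule.on tensor.

Definition tens (v : V) (w : W) : tensor := qpi tensor_rel (gen v w).

Lemma tens_bilinear :
  bilinear_for (GRing.Scale.Law.clone _ _ *:%R _)
               (GRing.Scale.Law.clone _ _ *:%R _) tens.
Proof.
split=> [w a v v'|v a w w']; rewrite /tens -linearP; apply/qpiP/lspan_incl.
- exact: tensor_rell.
- exact: tensor_relr.
Qed.

HB.instance Definition _ := bilinear_isBilinear.Build K V W tensor *:%R *:%R
  tens tens_bilinear.

Section Lift.
Variables (N : lmodType K) (f : {bilinear V -> W -> N}).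

Lemma tlift_rel x : tensor_rel x ->
  flift (fun p : V * W => f p.1 p.2) x = 0.
Proof.
by case=> [a v v' w|a v w w']; rewrite linearB linearP /= !flift_gen /=;
  rewrite (linearPl, linearPr) subrr.
Qed.

Definition tlift : tensor -> N := qlift tlift_rel.

HB.instance Definition _ := GRing.Linear.on tlift.

Lemma tlift_tens v w : tlift (tens v w) = f v w.
Proof. by rewrite /tlift /tens qlift_pi /= flift_gen. Qed.

End Lift.

Lemma tensor_ext (N : lmodType K) (f g : {linear tensor -> N}) :
  (forall v w, f (tens v w) = g (tens v w)) -> f =1 g.
Proof.
move=> fg x; rewrite -(qrepK x).
by apply: (freemod_ext (f := f \o qpi _) (h := g \o qpi _)) => -[v w]; apply: fg.
Qed.

End Tensor.

Section TensorMap.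
Variables (K : fieldType) (V V' W W' : lmodType K).

Section Def.
Variables (f : {linear V -> V'}) (g : {linear W -> W'}).

Definition tmap_fun (v : V) (w : W) : tensor V' W' := tens (f v) (g w).

Lemma tmap_fun_bilinear :
  bilinear_for (GRing.Scale.Law.clone _ _ *:%R _)
               (GRing.Scale.Law.clone _ _ *:%R _) tmap_fun.
Proof.
by split=> [w a v v'|v a w w']; rewrite /tmap_fun linearP (linearPl, linearPr).
Qed.

HB.instance Definition _ := bilinear_isBilinear.Build K V W (tensor V' W')
  *:%R *:%R tmap_fun tmap_fun_bilinear.

Definition tmap : tensor V W -> tensor V' W' := tlift tmap_fun.

HB.instance Definition _ := GRing.Linear.on tmap.

Lemma tmap_tens v w : tmap (tens v w) = tens (f v) (g w).
Proof. exact: tlift_tens. Qed.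

End Def.
End TensorMap.

Section PreLie.
Variables (K : fieldType) (L : lmodType K) (op : {bilinear L -> L -> L}).

Definition prelie_identity := forall x y z : L,
  op (op x y) z - op x (op y z) = op (op x z) y - op x (op z y).

(* The action (x1 (x) x2) o y = (x1 o y) (x) x2 + x1 (x) (x2 o y). *)
Definition tact (t : tensor L L) (y : L) : tensor L L :=
  tmap (applyr op y) idfun t + tmap idfun (applyr op y) t.

End PreLie.

Section Coalgebra.
Variables (K : fieldType) (C : lmodType K).

Definition tau23_fun (t : tensor C C) (z : C) : tensor (tensor C C) C :=
  tmap (applyr (@tens K C C) z) idfun t.

Lemma tau23_fun_bilinear :
  bilinear_for (GRing.Scale.Law.clone _ _ *:%R _)
               (GRing.Scale.Law.clone _ _ *:%R _) tau23_fun.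
Proof.
split=> [z|t a z z']; first by move=> a t u; apply: linearP.
rewrite /tau23_fun.
pose f (x : C) : {linear tensor C C -> tensor (tensor C C) C} :=
  tmap (applyr (@tens K C C) x) (@idfun C).
have -> : a *: f z t + f z' t = (a \*: f z \+ f z') t by [].
apply: (tensor_ext (f := f _) (g := a \*: f z \+ f z')) => x y /=.
by rewrite !tmap_tens /= linearPr linearPl.
Qed.

HB.instance Definition _ := bilinear_isBilinear.Build K (tensor C C) C
  (tensor (tensor C C) C) *:%R *:%R tau23_fun tau23_fun_bilinear.

Definition tau23 : tensor (tensor C C) C -> tensor (tensor C C) C :=
  tlift tau23_fun.

Lemma tau23_tens x y z : tau23 (tens (tens x y) z) = tens (tens x z) y.
Proof. by rewrite /tau23 tlift_tens /= /tau23_fun tmap_tens. Qed.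

Variable D : {linear C -> tensor C C}.

Definition nap_coproduct := forall x : C,
  tmap D idfun (D x) - tau23 (tmap D idfun (D x)) = 0.

Definition prim : {pred C} := fun x => D x == 0.

Lemma primE x : (x \in prim) = (D x == 0).
Proof. by []. Qed.

Lemma prim_submod_closed : submod_closed prim.
Proof.
split=> [|a x y]; rewrite !primE; first by rewrite linear0.
by move=> /eqP Dx /eqP Dy; rewrite linearP Dx Dy scaler0 addr0.
Qed.

HB.instance Definition _ := GRing.isSubmodClosed.Build K C prim
  prim_submod_closed.

Record Prim := MkPrim { prim_val :> C; _ : prim_val \in prim }.

HB.instance Definition _ := [isSub for prim_val].
HB.instance Definition _ := [Choice of Prim by <:].
HB.instance Definition _ := [SubChoice_isSubLmodule of Prim by <:].

(* sum_tens F n is the subspace F_1 (x) F_(n-1) + .. + F_(n-1) (x) F_1. *)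
Definition sum_tens (F : nat -> C -> Prop) (n : nat) : tensor C C -> Prop :=
  lspan (fun t => exists i a b,
    [/\ 1 <= i <= n.-1, F i a, F (n - i) b & t = tens a b]%N).

(* The first argument only bounds the recursion. The equations for C_1 and for *)
(* C_n, n >= 2, are cfilt1 and cfiltS; cfilt 0 is empty.                       *)
Fixpoint cfilt_rec (m n : nat) (x : C) : Prop :=
  if m is m'.+1 then
    match n with
    | 0 => False
    | 1 => D x = 0
    | _ => sum_tens (cfilt_rec m') n (D x)
    end
  else False.

Definition cfilt (n : nat) : C -> Prop := cfilt_rec n n.

Lemma sum_tens_iff F G n t :
  (forall i x, (1 <= i <= n.-1)%N -> F i x <-> G i x) ->
  sum_tens F n t <-> sum_tens G n t.
Proof.
move=> FG; split;
  (elim=> [|a u v [i [b [c [lein Fb Fc ->]]]] _]; first exact: lspan0).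
all: apply: lspanP; exists i, b, c; split=> //; apply/FG => //.
all: by case: n lein {Fc FG} => [|n]; case: i {Fb} => //= i; rewrite subSS; lia.
Qed.

Lemma cfilt_recE m n x : (n <= m)%N -> cfilt_rec m n x <-> cfilt n x.
Proof.
rewrite /cfilt; elim/ltn_ind: n m x => n IH [|m] x lenm.
  by case: n {IH} lenm.
case: n IH lenm => [|[|n]] IH lenm //=.
apply: sum_tens_iff => i y /andP[_ lein].
have lt_in : (i < n.+2)%N by lia.
have le_im : (i <= m)%N by lia.
have le_in : (i <= n.+1)%N by lia.
by have := IH _ lt_in _ y le_im; have := IH _ lt_in _ y le_in; tauto.
Qed.

Lemma cfilt1 x : cfilt 1 x <-> D x = 0.
Proof. by []. Qed.

Lemma cfiltS n x : (2 <= n)%N -> cfilt n x <-> sum_tens cfilt n (D x).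
Proof.
case: n => [|[|n]] // _; apply: sum_tens_iff => i y /andP[_ lein].
exact (@cfilt_recE n.+1 i y lein).
Qed.

Definition connected_coproduct :=
  forall x : C, exists2 n, (1 <= n)%N & cfilt n x.

End Coalgebra.

Inductive rtree (I : Type) : Type := B of I & seq (rtree I).

Section RootedTrees.
Variable I : choiceType.

Lemma rtree_foldr_ind (P : rtree I -> Prop) :
  (forall v ts, foldr (fun t Q => P t /\ Q) True ts -> P (B v ts)) ->
  forall t, P t.
Proof. by move=> PB; fix IH 1 => -[v ts]; apply: PB; elim: ts. Qed.

Fixpoint rtree_encode (t : rtree I) : GenTree.tree I :=
  let: B v ts := t in
  GenTree.Node 0 (GenTree.Leaf v :: map rtree_encode ts).

Fixpoint rtree_decode (t : GenTree.tree I) : option (rtree I) :=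
  if t is GenTree.Node 0 (GenTree.Leaf v :: ts) then
    Some (B v (pmap rtree_decode ts))
  else None.

Lemma rtree_encodeK : pcancel rtree_encode rtree_decode.
Proof.
elim/rtree_foldr_ind => v ts IH /=; congr (Some (B v _)).
by elim: ts IH => //= t ts IHts [-> /IHts] /= ->.
Qed.

HB.instance Definition _ := Choice.copy (rtree I) (pcan_type rtree_encodeK).

Lemma rtree_in_ind (P : rtree I -> Prop) :
  (forall v ts, (forall t, t \in ts -> P t) -> P (B v ts)) ->
  forall t, P t.
Proof.
move=> PB; elim/rtree_foldr_ind => v ts Pts; apply: PB.
elim: ts Pts => //= t ts IH [Pt Pts] u; rewrite inE => /predU1P[->//|].
exact: IH.
Qed.

(* grafts T S lists the trees S o_v T, with one entry for each vertex v of S. *)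
Fixpoint grafts (T S : rtree I) : seq (rtree I) :=
  let: B v ts := S in
  B v (T :: ts) ::
    map (B v) ((fix graft_branches (ts : seq (rtree I)) :=
      if ts is t :: ts' then
        [seq u :: ts' | u <- grafts T t] ++
        [seq t :: us | us <- graft_branches ts']
      else [::]) ts).

(* The pairs (T_i, [:: T_1; ..; T_n] without its i-th entry), for i = 1, .., n. *)
Fixpoint picks (ts : seq (rtree I)) : seq (rtree I * seq (rtree I)) :=
  if ts is t :: ts' then (t, ts') :: [seq (p.1, t :: p.2) | p <- picks ts']
  else [::].

Lemma perm_swap2 (t u : rtree I) ts : perm_eq [:: t, u & ts] [:: u, t & ts].
Proof. exact/permEl/(perm_catCA [:: t] [:: u]). Qed.

Lemma picks_mem ts p : p \in picks ts -> p.1 \in ts.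
Proof.
elim: ts p => //= t ts IH p; rewrite !inE => /predU1P[->|]; first by rewrite eqxx.
by case/mapP => q /IH + -> /= => ->; rewrite orbT.
Qed.

Section PermInvariant.
Variable N : nmodType.

Lemma sum_picks (F : rtree I -> seq (rtree I) -> N) ts :
  (forall t us us', perm_eq us us' -> F t us = F t us') ->
  \sum_(p <- picks ts) F p.1 p.2 = \sum_(t <- ts) F t (rem t ts).
Proof.
elim: ts F => [|t ts IH] F Fperm; first by rewrite !big_nil.
rewrite /= !big_cons /= eqxx big_map /=; congr (_ + _).
rewrite (IH (fun u us => F u (t :: us))) => [|u us us' uus]; last first.
  by apply: Fperm; rewrite perm_cons.
rewrite big_seq [RHS]big_seq; apply: eq_bigr => u.
case: (t =P u) => [<- t_ts|//]; by apply: Fperm; rewrite perm_sym perm_to_rem.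
Qed.

Lemma perm_picks (F : rtree I -> seq (rtree I) -> N) ts ts' :
  (forall t us us', perm_eq us us' -> F t us = F t us') -> perm_eq ts ts' ->
  \sum_(p <- picks ts) F p.1 p.2 = \sum_(p <- picks ts') F p.1 p.2.
Proof.
move=> Fperm tts'; rewrite !sum_picks // (perm_big _ tts').
rewrite big_seq [RHS]big_seq; apply: eq_bigr => t t_ts'; apply: Fperm.
have t_ts : t \in ts by rewrite (perm_mem tts').
rewrite -(perm_cons t) -(permPl (perm_to_rem t_ts)).
exact: perm_trans tts' (perm_to_rem t_ts').
Qed.

Lemma sum_grafts (F : rtree I -> N) T v ts :
  (forall us us', perm_eq us us' -> F (B v us) = F (B v us')) ->
  \sum_(U <- grafts T (B v ts)) F U =
    F (B v (T :: ts)) +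
    \sum_(p <- picks ts) \sum_(U <- grafts T p.1) F (B v (U :: p.2)).
Proof.
rewrite /= big_cons big_map => Fperm; congr (_ + _).
have [G GE] : exists G, forall us, F (B v us) = G us by exists (F \o B v).
under eq_bigr do rewrite GE.
under [RHS]eq_bigr do under eq_bigr do rewrite GE.
have {F GE Fperm} : forall us us', perm_eq us us' -> G us = G us'.
  by move=> us us' /Fperm; rewrite !GE.
elim: ts G => [|t ts IH] G Gperm; first by rewrite !big_nil.
rewrite big_cat !big_map big_cons big_map; congr (_ + _).
rewrite (IH (fun us => G (t :: us))) => [|us us' uus]; last first.
  by apply: Gperm; rewrite perm_cons.
apply: eq_bigr => p _; apply: eq_bigr => U _; apply: Gperm.
exact: perm_swap2.
Qed.

End PermInvariant.

End RootedTrees.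

(* RT(V), i.e. the sum over n >= 1 of RT(n) (x)_{Sigma_n} V^{(x) n}, presented by *)
(* generators and relations: the class of t (x) (v_1 (x) .. (x) v_n) is given by  *)
(* the tree t with the vertex i labeled by v_i. Such decorated trees are taken up *)
(* to the order of the branches, and are linear in the label of each vertex.      *)
Section FreePreLie.
Variables (K : fieldType) (V : lmodType K).

Local Notation gen t := (fgen K (t : rtree V)).

Inductive tree_rel : freemod K (rtree V) -> Prop :=
| tree_rel_perm v ts ts' : perm_eq ts ts' ->
    tree_rel (gen (B v ts) - gen (B v ts'))
| tree_rel_label a v w ts :
    tree_rel (gen (B (a *: v + w) ts) - (a *: gen (B v ts) + gen (B w ts)))
| tree_rel_branch v ts x :
    tree_rel x -> tree_rel (flift (fun t => gen (B v (t :: ts))) x).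

Definition RT : Type := quotmod tree_rel.

HB.instance Definition _ := GRing.Lmodule.on RT.

Definition tree (t : rtree V) : RT := qpi tree_rel (gen t).

Lemma flift_tree D : flift tree D = qpi tree_rel D.
Proof.
rewrite {2}(freemodE D) linear_sum fliftE; apply: eq_bigr => t _.
by rewrite linearZ_LR.
Qed.

Lemma RT_ind (P : RT -> Prop) :
  P 0 -> (forall a t x, P x -> P (a *: tree t + x)) -> forall x, P x.
Proof.
move=> P0 PD x; rewrite -(qrepK x); elim/freemod_ind: (qrep x) => [|a t D PDD].
  by rewrite linear0.
by rewrite linearP; apply: PD.
Qed.

Lemma RT_ext (N : lmodType K) (f g : {linear RT -> N}) :
  (forall t, f (tree t) = g (tree t)) -> f =1 g.
Proof.
move=> fg; elim/RT_ind => [|a t x fgx]; first by rewrite !linear0.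
by rewrite !linearP fg fgx.
Qed.

Lemma tree_perm v ts ts' : perm_eq ts ts' -> tree (B v ts) = tree (B v ts').
Proof. by move=> tts'; apply/qpiP/lspan_incl/tree_rel_perm. Qed.

Lemma tree_label a v w ts :
  tree (B (a *: v + w) ts) = a *: tree (B v ts) + tree (B w ts).
Proof. by rewrite /tree -linearP; apply/qpiP/lspan_incl/tree_rel_label. Qed.

Lemma tree_branch_rel v ts x :
  tree_rel x -> flift (fun t => tree (B v (t :: ts))) x = 0.
Proof.
move=> /(tree_rel_branch v ts) /(@qpi_rel _ _ _ _) <-.
by rewrite -flift_comp.
Qed.

Definition add_branch v ts : RT -> RT := qlift (@tree_branch_rel v ts).

HB.instance Definition _ v ts := GRing.Linear.on (add_branch v ts).

Lemma add_branch_tree v ts t : add_branch v ts (tree t) = tree (B v (t :: ts)).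
Proof. by rewrite /add_branch /tree qlift_pi /= flift_gen. Qed.

Lemma add_branch_perm v ts ts' x :
  perm_eq ts ts' -> add_branch v ts x = add_branch v ts' x.
Proof.
move=> tts'; apply: (RT_ext (f := add_branch v ts)) => t.
by rewrite /= !add_branch_tree; apply: tree_perm; rewrite perm_cons.
Qed.

Lemma add_branch_label a v w ts x :
  add_branch (a *: v + w) ts x = a *: add_branch v ts x + add_branch w ts x.
Proof.
elim/RT_ind: x => [|b t x IH]; first by rewrite !linear0 addr0.
rewrite !linearP /= IH !add_branch_tree tree_label !scalerDr !scalerA mulrC.
by rewrite !addrA; congr (_ + _); rewrite addrAC.
Qed.

Definition circ_tree (T S : rtree V) : RT := \sum_(U <- grafts T S) tree U.

Lemma circ_treeE T v ts :
  circ_tree T (B v ts) = tree (B v (T :: ts)) +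
    \sum_(p <- picks ts) add_branch v p.2 (circ_tree T p.1).
Proof.
rewrite /circ_tree sum_grafts; last by move=> us us'; apply: tree_perm.
congr (_ + _); apply: eq_bigr => p _; rewrite linear_sum.
by apply: eq_bigr => U _; rewrite /= add_branch_tree.
Qed.

Lemma circ_tree_relr S x :
  tree_rel x -> flift (fun T => circ_tree T S) x = 0.
Proof.
move=> x0; elim/rtree_in_ind: S => v ts IH.
rewrite (eq_flift _ (fun T => circ_treeE T v ts)) fliftD.
rewrite tree_branch_rel // add0r flift_sum big_seq big1 // => p /picks_mem /IH p0.
by rewrite flift_comp p0 linear0.
Qed.

Lemma circ_tree_rell T x : tree_rel x -> flift (circ_tree T) x = 0.
Proof.
elim=> {x} [v ts ts' tts'|a v w ts|v ts x x0 IH].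
- rewrite linearB /= !flift_gen !circ_treeE.
  rewrite (@tree_perm _ (T :: ts) (T :: ts')) ?perm_cons //.
  rewrite (perm_picks (F := fun t us => add_branch v us (circ_tree T t)) _ tts').
    by rewrite subrr.
  by move=> t us us'; apply: add_branch_perm.
- rewrite linearB linearP /= !flift_gen !circ_treeE tree_label.
  under eq_bigr do rewrite add_branch_label.
  by rewrite big_split /= -scaler_sumr scalerDr addrACA subrr.
- rewrite -flift_comp.
  under eq_flift do rewrite /= flift_gen circ_treeE /= big_cons big_map /=.
  rewrite !fliftD flift_sum (flift_comp (add_branch v ts)) IH linear0 add0r.
  rewrite big1 ?addr0 => [|p _].
    rewrite -[RHS](tree_branch_rel v (T :: ts) x0); apply: eq_flift => t.
    exact/tree_perm/perm_swap2.
  under eq_flift do rewrite /circ_tree linear_sum.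
  rewrite flift_sum big1 // => U _.
  rewrite -[RHS](tree_branch_rel v (U :: p.2) x0); apply: eq_flift => t.
  by rewrite /= add_branch_tree; apply/tree_perm/perm_swap2.
Qed.

Definition circ_treer (T : rtree V) : RT -> RT := qlift (@circ_tree_rell T).

HB.instance Definition _ T := GRing.Linear.on (circ_treer T).

Lemma circ_treer_tree T S : circ_treer T (tree S) = circ_tree T S.
Proof. by rewrite /circ_treer /tree qlift_pi /= flift_gen. Qed.

Lemma circ_treer_rel x y : tree_rel y -> flift (fun T => circ_treer T x) y = 0.
Proof.
move=> y0; elim/RT_ind: x => [|a S x IH].
  by rewrite fliftE big1 // => T _; rewrite linear0 scaler0.
under eq_flift do rewrite linearP /= circ_treer_tree.
by rewrite fliftP IH circ_tree_relr // scaler0 addr0.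
Qed.

Definition RT_circ (x y : RT) : RT := qlift (@circ_treer_rel x) y.

Lemma RT_circ_bilinear :
  bilinear_for (GRing.Scale.Law.clone _ _ *:%R _)
               (GRing.Scale.Law.clone _ _ *:%R _) RT_circ.
Proof.
split=> [y a x x'|x a y y']; rewrite /RT_circ; last exact: linearP.
rewrite -(qrepK y) !qlift_pi -fliftP /=.
by apply: eq_flift => T; rewrite linearP.
Qed.

HB.instance Definition _ := bilinear_isBilinear.Build K RT RT RT *:%R *:%R
  RT_circ RT_circ_bilinear.

Lemma RT_circ_tree S T :
  RT_circ (tree S) (tree T) = \sum_(U <- grafts T S) tree U.
Proof. by rewrite /RT_circ {2}/tree qlift_pi /= flift_gen circ_treer_tree. Qed.

Definition delta_tree (S : rtree V) : tensor RT RT :=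
  let: B v ts := S in
  \sum_(p <- picks ts) tens (tree (B v p.2)) (tree p.1).

Lemma delta_tree_rel x : tree_rel x -> flift delta_tree x = 0.
Proof.
case=> {x} [v ts ts' tts'|a v w ts|v ts x x0].
- rewrite linearB /= !flift_gen /=.
  rewrite (perm_picks (F := fun t us => tens (tree (B v us)) (tree t)) _ tts').
    by rewrite subrr.
  by move=> t us us' /tree_perm ->.
- rewrite linearB linearP /= !flift_gen /=.
  under eq_bigr do rewrite tree_label linearPl.
  by rewrite big_split /= -scaler_sumr subrr.
- rewrite -flift_comp.
  under eq_flift do rewrite /= flift_gen /= big_cons big_map /=.
  pose h : {linear RT -> tensor RT RT} :=
    (@tens K RT RT : {bilinear RT -> RT -> tensor RT RT}) (tree (B v ts)).
  rewrite fliftD flift_sum (flift_comp h) flift_tree qpi_rel // linear0 add0r.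
  rewrite big1 // => p _.
  rewrite (flift_comp (applyr (@tens K RT RT) (tree p.1))) tree_branch_rel //.
  exact: linear0.
Qed.

Definition RT_delta : RT -> tensor RT RT := qlift delta_tree_rel.

HB.instance Definition _ := GRing.Linear.on RT_delta.

Lemma RT_delta_tree v ts :
  RT_delta (tree (B v ts)) =
    \sum_(p <- picks ts) tens (tree (B v p.2)) (tree p.1).
Proof. by rewrite /RT_delta /tree qlift_pi /= flift_gen. Qed.

End FreePreLie.

(* Main.v *)
From HB Require Import structures.
Require Import Defs.
From mathcomp Require Import all_boot all_order all_algebra.
From mathcomp Require Import sesquilinear ssrAC zify boolp classical_sets.

Set Implicit Arguments.
Unset Strict Implicit.
Unset Printing Implicit Defensive.

Import GRing.Theory.
Local Open Scope ring_scope.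

(** Let V = Prim H.  Symmetric braces h{h_1, .., h_n} on H (Oudom-Guin) give a
    pre-Lie morphism F : RT(V) -> H sending B(v, T_1, .., T_n) to
    v{F(T_1), .., F(T_n)}; since v is primitive, the compatibility relation
    makes F a coalgebra morphism.  In characteristic 0 the weighted root grafting
    G(B(v, T_1, .., T_n) (x) T) = B(v, T, T_1, .., T_n) / (n + 1) satisfies
    G Delta = id on trees with an edge, and Delta G u = u as soon as
    (Delta (x) id) u is invariant under tau_23.  The first fact yields left
    inverses of F on trees of bounded size, so F is injective; the second one
    lifts the coproduct of an element of H through F, so F is surjective by
    induction on the coradical degree. *)

(** * Sums over the removal of one entry of a list *)

Section SumRem.
Variables (T : eqType) (N : nmodType).
Implicit Types (F : T -> seq T -> N) (s : seq T).

(** The length is fixed because, during the induction that proves braces symmetric, symmetry is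
    known for shorter lists only. *)
Definition perm_inv_at n F := forall x s s',
  size s = n -> perm_eq s s' -> F x s = F x s'.

(** As [rem] deletes the first copy, equal entries give equal summands. This agrees with removal by
    position when [F] ignores the order of its list. *)
Definition sum_rem F s := \sum_(x <- s) F x (rem x s).

Lemma eq_sum_rem F G s :
  (forall x s', (size s').+1 = size s -> F x s' = G x s') ->
  sum_rem F s = sum_rem G s.
Proof.
move=> FG; rewrite /sum_rem big_seq [RHS]big_seq; apply: eq_bigr => x xs.
by apply: FG; rewrite size_rem // prednK //; case: s xs.
Qed.

Lemma sum_rem_perm F n s s' : perm_inv_at n F -> (size s = n.+1) ->
  perm_eq s s' -> sum_rem F s = sum_rem F s'.
Proof.
move=> Fp sn ss'; rewrite /sum_rem (perm_big _ ss') /= big_seq [RHS]big_seq.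
apply: eq_bigr => x xs'; have xs : x \in s by rewrite (perm_mem ss').
apply: Fp; first by rewrite size_rem // sn.
rewrite -(perm_cons x) -(permPl (perm_to_rem xs)).
exact: perm_trans ss' (perm_to_rem xs').
Qed.

Lemma sum_rem_cons F n x s : perm_inv_at n F -> size s = n ->
  sum_rem F (x :: s) = F x s + sum_rem (fun y s' => F y (x :: s')) s.
Proof.
move=> Fp sn; rewrite /sum_rem big_cons /= eqxx; congr (_ + _).
rewrite big_seq [RHS]big_seq; apply: eq_bigr => y ys.
case: (x =P y) => [xy|//]; apply: Fp => //; rewrite xy; exact: perm_to_rem.
Qed.

Lemma sum_remD F G s :
  sum_rem (fun x s' => F x s' + G x s') s = sum_rem F s + sum_rem G s.
Proof. exact: big_split. Qed.

(** Both sides run over ordered pairs of distinct positions. Separating the pairs that involve the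
    head leaves a double sum over the tail, exchanged by induction. *)
Lemma sum_rem_exchange_aux (F : T -> T -> seq T -> N) n s :
  (forall x, perm_inv_at n (F x)) -> size s = n.+2 ->
  sum_rem (fun x => sum_rem (F x)) s =
  sum_rem (fun x => sum_rem (fun y => F y x)) s.
Proof.
have [m] := ubnP n; elim: m => // m IH in n F s *; rewrite ltnS => nm Fp.
case: s => [//|x s] [sn].
have FTp y : perm_inv_at n (F^~ y) by move=> z s1 s2 *; apply: Fp.
rewrite (@sum_rem_cons _ n.+1) //; last first.
  by move=> z s1 s2 s1n; apply: sum_rem_perm (Fp z) _.
rewrite [in RHS](@sum_rem_cons _ n.+1) //; last first.
  by move=> z s1 s2 s1n; apply: sum_rem_perm (FTp z) _.
rewrite (_ : sum_rem (fun y s' => sum_rem (F y) (x :: s')) s =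
  sum_rem (F^~ x) s +
  sum_rem (fun y => sum_rem (fun z s' => F y z (x :: s'))) s).
  rewrite (_ : sum_rem (fun y s' => sum_rem (F^~ y) (x :: s')) s =
    sum_rem (F x) s +
    sum_rem (fun y => sum_rem (fun z s' => F z y (x :: s'))) s).
    rewrite addrCA; congr (_ + (_ + _)).
    (* For [n = 0] the tail has one entry, so both double sums over it are empty. *)
    case: n => [|n] in sn nm Fp FTp *.
      case: s sn => [|y [|]] // _.
      by rewrite /sum_rem !big_seq1 /= eqxx !big_nil.
    apply: (IH n) => // y z s1 s2 s1n p12; apply: Fp; first by rewrite /= s1n.
    by rewrite perm_cons.
  rewrite -sum_remD; apply: eq_sum_rem => y s'; rewrite sn => -[s'n].
  by rewrite (@sum_rem_cons _ n).
rewrite -sum_remD; apply: eq_sum_rem => y s'; rewrite sn => -[s'n].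
by rewrite (@sum_rem_cons _ n).
Qed.

Lemma sum_rem_exchange (F : T -> T -> seq T -> N) s :
  (forall n x, size s = n.+2 -> perm_inv_at n (F x)) ->
  sum_rem (fun x => sum_rem (F x)) s =
  sum_rem (fun x => sum_rem (fun y => F y x)) s.
Proof.
case: s => [|x [|y s]] Fp.
- by rewrite /sum_rem !big_nil.
- by rewrite /sum_rem !big_seq1 /= eqxx !big_nil.
- by apply: (sum_rem_exchange_aux (n := size s)) => // z; apply: Fp.
Qed.

End SumRem.

(** If [f] identifies entries, [rem (f x)] may delete an earlier one than [x], hence a permutation
    and not an equality. *)
Lemma perm_map_rem (T U : eqType) (f : T -> U) x s : x \in s ->
  perm_eq (rem (f x) (map f s)) (map f (rem x s)).
Proof.
move=> xs; rewrite -(perm_cons (f x)) perm_sym -map_cons.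
apply: (@perm_trans _ (map f s)).
  by apply: perm_map; rewrite perm_sym perm_to_rem.
exact/perm_to_rem/map_f.
Qed.

Lemma sum_rem_map (T U : eqType) (N : nmodType) (f : T -> U)
    (F : U -> seq U -> N) s :
  (forall n, perm_inv_at n F) ->
  sum_rem F (map f s) = sum_rem (fun x s' => F (f x) (map f s')) s.
Proof.
move=> Fp; rewrite /sum_rem big_map big_seq [RHS]big_seq.
apply: eq_bigr => x xs; apply: (Fp (size (rem (f x) (map f s)))) => //.
exact: perm_map_rem.
Qed.

(** * Linear left inverses by Zorn's lemma *)

Section LeftInverse.
Variables (K : fieldType) (A C : lmodType K) (f : {linear A -> C}).
Hypothesis f_inj : injective f.

Local Open Scope classical_set_scope.

(** As [f] is injective, this means that the span of [S] meets the image of [f] trivially; a maximal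
    such [S] spans a complement. *)
Let avoids (S : set C) := forall x, lspan S (f x) -> x = 0.

Lemma lspanS (S S' : set C) x : S `<=` S' -> lspan S x -> lspan S' x.
Proof.
move=> SS'; elim=> [|a u v Su _ IH]; first exact: lspan0.
by apply: lspanP => //; apply: SS'.
Qed.

(** A combination uses finitely many generators, which lie in one member of the chain. The
    alternative [x = 0] covers the empty chain. *)
Lemma lspan_bigcup (F : set (set C)) x : total_on F subset ->
  lspan (\bigcup_(S in F) S) x -> x = 0 \/ exists2 S, F S & lspan S x.
Proof.
move=> Ftot; elim=> [|a u v [S FS Su] _ [->|[S' FS' S'v]]]; first by left.
- by right; exists S => //; rewrite addr0; apply/lspanZ/lspan_incl.
- right; case: (Ftot _ _ FS FS') => SS'.
  + by exists S' => //; apply: lspanP => //; apply: SS'.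
  + by exists S => //; apply: lspanP => //; apply: lspanS S'v.
Qed.

Lemma lspan_set1U (S : set C) b x : lspan (S `|` [set b]) x ->
  exists a y, lspan S y /\ x = a *: b + y.
Proof.
elim=> [|a u v [Su|->] _ [a' [y [Sy ->]]]].
- by exists 0, 0; rewrite scale0r addr0; split=> //; exact: lspan0.
- exists a', (a *: u + y); split; last by rewrite addrCA.
  exact: lspanP.
- by exists (a + a'), y; rewrite scalerDl addrA.
Qed.

Lemma complement_image : exists S : set C,
  avoids S /\ forall b, exists x, lspan S (b - f x).
Proof.
have [F Fav Ftot|S [Sav Smax]] := @Zorn_bigcup C avoids.
  move=> x /(lspan_bigcup Ftot)[/eqP|[S FS]]; last exact: Fav.
  by rewrite -(raddf0 f) => /eqP/f_inj.
exists S; split=> // b; apply: contrapT => bS.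
have nSb : ~ S b.
  by move=> Sb; apply: bS; exists 0; rewrite raddf0 subr0; apply: lspan_incl.
suff avb : avoids (S `|` [set b]).
  apply: (Smax (S `|` [set b])) => //; split; first by apply: subsetUl.
  by move=> /(_ b (or_intror erefl)).
(* A relation with [a != 0] could be solved for [b], placing [b] in the image of [f] plus the span
   of [S], against [bS]. *)
move=> x /lspan_set1U[a [y [Sy fx]]].
have [a0|a0] := eqVneq a 0.
  by apply: Sav; rewrite fx a0 scale0r add0r.
case: bS; exists (a^-1 *: x).
rewrite linearZ /= fx scalerDr scalerA mulVf // scale1r opprD addNKr.
by rewrite -scaleNr; apply: lspanZ.
Qed.

(** The inverse is the projection along the complement; it is linear because the component in the
    image is unique ([gE]). *)
Lemma linear_left_inverse : exists g : {linear C -> A}, cancel f g.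
Proof.
have [S [Sav Sall]] := complement_image.
pose g b := projT1 (cid (Sall b)).
have gP b : lspan S (b - f (g b)) by apply: (projT2 (cid (Sall b))).
have gE b x : lspan S (b - f x) -> g b = x.
  move=> Sx; apply/eqP; rewrite -subr_eq0; apply/eqP/Sav.
  rewrite raddfB (_ : _ - _ = (b - f x) - (b - f (g b))); last first.
    by rewrite opprB [RHS]addrC addrA subrK.
  by apply: lspanD => //; rewrite -scaleN1r; apply: lspanZ.
have glin : linear g.
  move=> a b c; apply: gE; rewrite linearP opprD addrACA -scalerBr.
  by apply: lspanD => //; apply: lspanZ.
pose gl := GRing.isLinear.Build K C A *:%R g glin.
pose G : {linear C -> A} := HB.pack g gl.
exists G => x; apply: gE; rewrite subrr; exact: lspan0.
Qed.

End LeftInverse.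

Lemma sum_rem_scale (K : fieldType) (T : eqType) (M : lmodType K) a
    (F : T -> seq T -> M) s :
  sum_rem (fun x s' => a *: F x s') s = a *: sum_rem F s.
Proof. by rewrite /sum_rem scaler_sumr. Qed.

Lemma sum_remN (T : eqType) (M : zmodType) (F : T -> seq T -> M) s :
  sum_rem (fun x s' => - F x s') s = - sum_rem F s.
Proof. by rewrite /sum_rem sumrN. Qed.

(** * Symmetric braces of a pre-Lie algebra *)

Section Brace.
Variables (K : fieldType) (L : lmodType K) (op : {bilinear L -> L -> L}).
Hypothesis prelieL : prelie_identity op.

(** The lists in the recursive calls are shorter but not all sublists of the given one, so [n]
    bounds the recursion by length. *)
Fixpoint brace_rec n (a : L) (s : seq L) : L :=
  if (n, s) is (n'.+1, y :: s') then
    op (brace_rec n' a s') y -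
      sum_rem (fun x s'' => brace_rec n' a (op x y :: s'')) s'
  else a.

(* Locked, as unification would otherwise unfold the recursion. *)
Definition brace := locked (fun (a : L) (s : seq L) => brace_rec (size s) a s).

Lemma brace_nil a : brace a [::] = a.
Proof. by rewrite /brace -lock. Qed.

Lemma brace_cons a y s :
  brace a (y :: s) =
    op (brace a s) y - sum_rem (fun x s' => brace a (op x y :: s')) s.
Proof.
rewrite /brace -lock /=; congr (_ - _); apply: eq_sum_rem => x s' s's.
by rewrite -s's.
Qed.

Lemma brace_label c a b s : brace (c *: a + b) s = c *: brace a s + brace b s.
Proof.
have [n] := ubnP (size s); elim: n s => // n IH [|y s] ns.
  by rewrite !brace_nil.
rewrite !brace_cons IH //= linearPl.
rewrite (@eq_sum_rem _ _ _
  (fun x s' => c *: brace a (op x y :: s') + brace b (op x y :: s'))).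
  by rewrite sum_remD sum_rem_scale scalerBr opprD addrACA.
by move=> x s' s's; apply: IH; rewrite /= s's.
Qed.

(** Linearity at the head suffices, since [tree_rel_branch] puts the varying branch first. *)
Lemma brace_head a c y z s :
  brace a (c *: y + z :: s) = c *: brace a (y :: s) + brace a (z :: s).
Proof.
have [n] := ubnP (size s); elim: n y z s => // n IH y z s ns.
rewrite !brace_cons linearPr.
rewrite (@eq_sum_rem _ _ _
  (fun x s' => c *: brace a (op x y :: s') + brace a (op x z :: s'))).
  by rewrite sum_remD sum_rem_scale scalerBr opprD addrACA.
by move=> x s' s's; rewrite linearPr; apply: IH; rewrite s's.
Qed.

Lemma brace_headD a y z s :
  brace a (y + z :: s) = brace a (y :: s) + brace a (z :: s).
Proof. by rewrite -[y in LHS]scale1r brace_head scale1r. Qed.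

Lemma brace_head0 a s : brace a (0 :: s) = 0.
Proof.
by apply: (@addIr _ (brace a (0 :: s))); rewrite -brace_headD addr0 add0r.
Qed.

Let inv n := forall a s s',
  size s = n -> perm_eq s s' -> brace a s = brace a s'.

(* Both sides are expanded twice. What is not visibly symmetric in y and z
   becomes so by the pre-Lie identity and by exchanging the two removals. *)
Lemma brace_swap n a y z s :
  (forall m, (m <= n.+1)%N -> inv m) -> size s = n ->
  brace a (y :: z :: s) = brace a (z :: y :: s).
Proof.
move=> invn sn.
(* In [E] neither [y] nor [z] acts on an entry of [s]; in [F] one of them does and the other
   multiplies the brace; in [G] both act on the same entry, in [H] on different ones. *)
pose E y z := op (op (brace a s) z) y - op (brace a s) (op z y).
pose F y z x l := op (brace a (op x z :: l)) y.
pose G y z x l := brace a (op x (op z y) :: l) + brace a (op (op x y) z :: l).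
pose H y z x := sum_rem (fun u l => brace a (op u z :: op x y :: l)).
have br2E y' z' : brace a (y' :: z' :: s) =
  E y' z' + (sum_rem (G y' z') s + sum_rem (fun x => H y' z' x) s)
   - (sum_rem (F y' z') s + sum_rem (F z' y') s).
  rewrite brace_cons (@sum_rem_cons _ _ _ n) //; last first.
    move=> x l l' ln ll'; apply: (invn n.+1) => //=; first by rewrite ln.
    by rewrite perm_cons.
  rewrite !brace_cons linearBl.
  rewrite (@eq_sum_rem _ _ (fun x l => brace a [:: op x y', z' & l])
    (fun x l => F z' y' x l + (- brace a (op (op x y') z' :: l)
       + - H y' z' x l))); last first.
    move=> x l ls.
    (* Symmetry at length [n.+1] brings [z'] to the front, where the recursion can expand it. *)
    have -> : brace a [:: op x y', z' & l] = brace a [:: z', op x y' & l].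
      apply: (invn n.+1) => //=; first by rewrite ls sn.
      exact/permEl/(perm_catCA [:: _] [:: _]).
    rewrite brace_cons (@sum_rem_cons _ _ _ (size l)) //; last first.
      move=> u l1 l2 l1l ll; apply: (invn n) => //=; first by rewrite l1l ls.
      by rewrite perm_cons.
    by rewrite opprD.
  rewrite sum_remD sum_remD !sum_remN /G sum_remD /E.
  have -> : op (sum_rem (fun x l => brace a (op x z' :: l)) s) y' =
     sum_rem (F y' z') s by rewrite -/(applyr op y' _) linear_sum.
  by rewrite !opprD !opprK !addrA [LHS](ACl (1*3*4*6*7*2*5)).
rewrite !br2E [in LHS](addrC (sum_rem (F y z) s)); congr (_ + (_ + _) - _).
- exact: prelieL.
- apply: eq_sum_rem => x l _; rewrite /G -!brace_headD.
  congr (brace a (_ :: l)).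
  have /eqP := prelieL x y z; rewrite subr_eq => /eqP ->.
  by rewrite addrA addrC; congr (_ + _); rewrite addrC subrK.
- rewrite [LHS]sum_rem_exchange => [|m x sm u l l' lm ll'].
    apply: eq_sum_rem => x l ls; apply: eq_sum_rem => u l' l's.
    apply: (invn n) => //=; first by rewrite l's -sn -ls.
    exact/permEl/(perm_catCA [:: _] [:: _]).
  apply: (invn n) => //=; first by rewrite lm -sm.
  by rewrite !perm_cons.
Qed.

(** By strong induction on the length: a change of tail under a fixed head reduces to shorter
    braces, and [brace_swap] exchanges the first two entries. *)
Lemma brace_perm a s s' : perm_eq s s' -> brace a s = brace a s'.
Proof.
suff: inv (size s) by apply.
elim/ltn_ind: (size s) => n IH {}a {}s {}s' sn ss'.
have tail x t t' : (size t < n)%N -> perm_eq t t' ->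
    brace a (x :: t) = brace a (x :: t').
  move=> + tt'; rewrite !brace_cons => tn; rewrite (IH _ tn a t t') //.
  congr (_ - _).
  case tm: (size t) => [|m].
    move/size0nil: tm tt' => ->; rewrite perm_sym.
    by move=> /perm_nilP ->.
  apply: (sum_rem_perm _ tm tt') => y l l' lm ll'; apply: (IH m.+1) => //=.
  - by rewrite -tm.
  - by rewrite lm.
  - by rewrite perm_cons.
case: s => [|x s] in sn ss' *.
  by move: ss'; rewrite perm_sym => /perm_nilP ->.
case: s' => [|y s'] in ss' *; first by move/perm_nilP: ss'.
have [xy|xy] := eqVneq x y.
  rewrite -xy in ss' *; apply: tail; first by rewrite -sn.
  by rewrite -(perm_cons x).
(* Distinct heads are exchanged by passing through [x :: y :: rem x s'] and [y :: x :: rem x s']. *)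
have xs' : x \in s'.
  by have := perm_mem ss' x; rewrite !inE eqxx (negPf xy).
have s'E := perm_to_rem xs'.
have ss2 : perm_eq s (y :: rem x s').
  rewrite -(perm_cons x) (perm_trans ss') //.
  rewrite (perm_trans (y := [:: y, x & rem x s'])) ?perm_cons //.
  exact/permEl/(perm_catCA [:: _] [:: _]).
rewrite (tail x s _ _ ss2) -?sn // (@brace_swap (size (rem x s'))) //.
  apply: tail; last by rewrite perm_sym.
  by rewrite -sn /= (perm_size ss2).
by move=> m mle; apply: IH; rewrite -sn /= (perm_size ss2).
Qed.

Lemma brace_perm_inv n a y : perm_inv_at n (fun x l => brace a (op x y :: l)).
Proof. by move=> x l l' _ ll'; apply: brace_perm; rewrite perm_cons. Qed.

End Brace.

Lemma linear_sum_rem (K : fieldType) (T : eqType) (M N : lmodType K)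
    (f : {linear M -> N}) (F : T -> seq T -> M) s :
  f (sum_rem F s) = sum_rem (fun x s' => f (F x s')) s.
Proof. exact: linear_sum. Qed.

(** * The coproduct of a brace with primitive root *)

Section BraceCoproduct.
Variables (K : fieldType) (L : lmodType K) (op : {bilinear L -> L -> L}).
Variable (D : {linear L -> tensor L L}).
Hypothesis prelieL : prelie_identity op.
Hypothesis compatL : forall a b, D (op a b) = tens a b + tact op (D a) b.

Lemma tact_tens a b y :
  tact op (tens a b) y = tens (op a y) b + tens a (op b y).
Proof. by rewrite /tact !tmap_tens. Qed.

Lemma tact_sum_rem (T : eqType) (F : T -> seq T -> tensor L L) s y :
  tact op (sum_rem F s) y = sum_rem (fun x l => tact op (F x l) y) s.
Proof. by rewrite /tact !linear_sum_rem -sum_remD. Qed.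

(** By induction on the length. The terms where [y] acts on the right factor cancel against the
    corrections in [brace_cons]; those where it acts on the left factor, with the remaining
    corrections, rebuild braces that have [y] as head. *)
Lemma brace_coproduct v s : D v = 0 ->
  D (brace op v s) = sum_rem (fun w l => tens (brace op v l) w) s.
Proof.
move=> Dv; have [n] := ubnP (size s); elim: n s => // n IH [|y s] ns.
  by rewrite brace_nil Dv /sum_rem big_nil.
rewrite brace_cons linearB compatL IH // tact_sum_rem linear_sum_rem.
rewrite (@eq_sum_rem _ _ (fun x l => D _) (fun x l =>
   tens (brace op v l) (op x y)
   + sum_rem (fun w l' => tens (brace op v (op x y :: l')) w) l)); last first.
  move=> x l ls; rewrite IH /= ?ls // (@sum_rem_cons _ _ _ (size l)) //.
  by move=> u l1 l2 _ l12; rewrite (brace_perm prelieL _ l12).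
rewrite (@sum_rem_cons _ _ _ (size s)) //; last first.
  by move=> u l1 l2 _ l12; rewrite (brace_perm prelieL _ l12).
rewrite -addrA; congr (_ + _).
under eq_sum_rem => x l _ do rewrite tact_tens.
under [RHS]eq_sum_rem => x l _ do rewrite brace_cons linearBl /=.
rewrite !sum_remD sum_remN opprD addrA addrK; congr (_ - _).
rewrite [LHS](sum_rem_exchange
  (F := fun x w l => tens (brace op v (op x y :: l)) w))
  => [|m x _ w l l' _ ll'].
  apply: eq_sum_rem => x l _; rewrite -[RHS]/(applyr (@tens K L L) x _).
  by rewrite linear_sum_rem.
by rewrite (@brace_perm _ _ _ prelieL _ _ (op x y :: l')) // perm_cons.
Qed.

End BraceCoproduct.

(** * The morphism from decorated trees to the pre-Lie algebra *)

Section Realization.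
Variables (K : fieldType) (L V : lmodType K) (op : {bilinear L -> L -> L}).
Variable (i : {linear V -> L}).
Hypothesis prelieL : prelie_identity op.

Fixpoint tree_brace (t : rtree V) : L :=
  let: B v ts := t in brace op (i v) (map tree_brace ts).

Lemma brace_flift (T : choiceType) a (g : T -> L) s (x : freemod K T) :
  flift (fun t => brace op a (g t :: s)) x = brace op a (flift g x :: s).
Proof.
elim/freemod_ind: x => [|c t x IH].
  by rewrite !linear0 brace_head0.
by rewrite !linearP /= !flift_gen IH brace_head.
Qed.

(** The three relations correspond to the symmetry of braces, their linearity in the root and their
    linearity in the first argument. *)
Lemma tree_brace_rel x : tree_rel x -> flift tree_brace x = 0.
Proof.
elim=> {x} [v ts ts' tts'|a v w ts|v ts x x0 IH].
- rewrite linearB /= !flift_gen /= (brace_perm prelieL _ (perm_map _ tts')).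
  exact: subrr.
- by rewrite linearB linearP /= !flift_gen /= linearP brace_label subrr.
- rewrite -flift_comp /=.
  under eq_flift do rewrite flift_gen /=.
  by rewrite brace_flift IH brace_head0.
Qed.

Definition realize : RT V -> L := qlift tree_brace_rel.

HB.instance Definition _ := GRing.Linear.on realize.

Lemma realize_tree v ts :
  realize (tree (B v ts)) = brace op (i v) (map (fun t => realize (tree t)) ts).
Proof.
have realizeE t : realize (tree t) = tree_brace t.
  by rewrite /realize /tree qlift_pi /= flift_gen.
by rewrite realizeE; congr brace; apply: eq_map => t; rewrite realizeE.
Qed.

Local Notation real_seq ts := (map (fun t => realize (tree t)) ts).

Lemma realize_add_branch v ts x :
  realize (add_branch v ts x) = brace op (i v) (realize x :: real_seq ts).
Proof.
elim/RT_ind: x => [|a t x IH]; first by rewrite !linear0 brace_head0.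
by rewrite !linearP /= brace_head IH add_branch_tree realize_tree.
Qed.

(** Grafting at the root adds an argument to the brace. By [brace_cons] this is the product minus
    the terms where [T] acts on one branch, which by induction are the graftings inside branches. *)
Lemma realize_circ_tree S T :
  realize (circ_tree T S) = op (realize (tree S)) (realize (tree T)).
Proof.
elim/rtree_in_ind: S => v ts IH; rewrite circ_treeE linearD linear_sum /=.
rewrite !realize_tree /= brace_cons.
under [X in _ + X]eq_bigr => p _ do rewrite realize_add_branch.
rewrite (sum_picks (F := fun t us => brace op (i v)
   (realize (circ_tree T t) :: real_seq us))); last first.
  move=> t us us' uu'; apply: brace_perm => //.
  by rewrite perm_cons perm_map.
rewrite sum_rem_map => [|n]; last first.
  by move=> x l l' ln ll'; apply: (brace_perm_inv prelieL) ln ll'.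
rewrite /sum_rem -addrA [- _ + _]addrC -sumrB big_seq big1 ?addr0 // => t tts.
by rewrite IH // subrr.
Qed.

Lemma realize_circ x y : realize (RT_circ x y) = op (realize x) (realize y).
Proof.
elim/RT_ind: x => [|a S x IH]; first by rewrite !(linear0, linear0l).
rewrite linearPl linearP [realize (_ + x)]linearP linearPl /= IH.
congr (_ *: _ + _).
elim/RT_ind: y {IH} => [|b T y IH]; first by rewrite !(linear0, linear0r).
rewrite linearPr linearP [realize (_ + y)]linearP linearPr /= IH.
by congr (_ *: _ + _); rewrite RT_circ_tree -realize_circ_tree.
Qed.

Section Coalgebra.
Variable (D : {linear L -> tensor L L}).
Hypothesis compatL : forall a b, D (op a b) = tens a b + tact op (D a) b.
Hypothesis prim_i : forall v, D (i v) = 0.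

Lemma realize_coproduct x :
  D (realize x) = tmap realize realize (RT_delta x).
Proof.
elim/RT_ind: x => [|a [v ts] x IH]; first by rewrite !linear0.
rewrite !linearP /= IH; congr (_ *: _ + _).
rewrite realize_tree (brace_coproduct prelieL compatL) // RT_delta_tree.
rewrite (sum_picks (F := fun t us => tens (tree (B v us)) (tree t)));
  last first.
  by move=> t us us' /tree_perm ->.
rewrite linear_sum sum_rem_map => [|n x0 l l' _ ll'].
  by apply: eq_bigr => t _; rewrite /= tmap_tens /= realize_tree.
by rewrite (brace_perm prelieL _ ll').
Qed.

End Coalgebra.

End Realization.

HB.instance Definition _ (K : fieldType) (C : lmodType K) :=
  GRing.Linear.on (@tau23 K C).

Lemma tensor_ind (K : fieldType) (V W : lmodType K) (P : tensor V W -> Prop) :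
  P 0 -> (forall a v w t, P t -> P (a *: tens v w + t)) -> forall t, P t.
Proof.
move=> P0 PD t; rewrite -(qrepK t); elim/freemod_ind: (qrep t) => [|a [v w] D].
  by rewrite linear0.
by rewrite linearP; apply: PD.
Qed.

Lemma tau23_natural (K : fieldType) (C C' : lmodType K)
    (f : {linear C -> C'}) t :
  tau23 (tmap (tmap f f) f t) = tmap (tmap f f) f (tau23 t).
Proof.
pose l : {linear _ -> tensor (tensor C' C') C'} :=
  @tau23 K C' \o tmap (tmap f f) f.
pose r : {linear _ -> tensor (tensor C' C') C'} :=
  tmap (tmap f f) f \o @tau23 K C.
rewrite -[LHS]/(l t) -[RHS]/(r t); apply: tensor_ext => u z.
(* For fixed [z] both sides are linear in [u], so [tensor_ext] applies again. *)
rewrite -[LHS]/((l \o applyr (@tens K _ _) z) u).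
rewrite -[RHS]/((r \o applyr (@tens K _ _) z) u).
apply: tensor_ext => x y; rewrite /l /r /=.
by rewrite tau23_tens tmap_tens /= tmap_tens tau23_tens !tmap_tens /= tmap_tens.
Qed.

(** * Weighted grafting at the root *)

Section Star.
Variables (K : fieldType) (V : lmodType K).
Hypothesis charK0 : [pchar K] =i pred0.

Section Weight.
Variable c : nat.

(** The offset [c = 1] gives the weight of G; [c = 2] gives the same weight for a tree that has
    already lost one branch. *)
Definition star_tree (y : RT V) (t : rtree V) : RT V :=
  let: B v ts := t in (size ts + c)%:R^-1 *: add_branch v ts y.

Lemma star_tree_rel y x : tree_rel x -> flift (star_tree y) x = 0.
Proof.
case=> {x} [v ts ts' tts'|a v w ts|v ts x x0].
- rewrite linearB /= !flift_gen /= (perm_size tts') (add_branch_perm v y tts').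
  exact: subrr.
- rewrite linearB linearP /= !flift_gen /= add_branch_label scalerDr !scalerA.
  by rewrite [_^-1 * a]mulrC subrr.
- rewrite -flift_comp /=; under eq_flift do rewrite flift_gen /=.
  pose f z : {linear RT V -> RT V} := add_branch v (z :: ts).
  elim/RT_ind: y => [|b t y IH].
    by rewrite fliftE big1 // => t _; rewrite linear0 !scaler0.
  under eq_flift do rewrite linearP scalerDr scalerA mulrC -scalerA.
  rewrite fliftP IH addr0 /=.
  (* Exchanging the two front branches makes the expression a linear image of the class of the
     varying branch, which is zero. *)
  rewrite (@eq_flift _ _ _ _ (fun u =>
      (size ts + c).+1%:R^-1 *: add_branch v (t :: ts) (tree u))); last first.
    move=> u; rewrite !add_branch_tree; congr (_ *: _).
    exact/tree_perm/perm_swap2.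
  rewrite (flift_comp (_ \*: add_branch v (t :: ts))) flift_tree qpi_rel //.
  by rewrite linear0 scaler0.
Qed.

Definition star (x y : RT V) : RT V := qlift (@star_tree_rel y) x.

Lemma star_treel v ts y :
  star (tree (B v ts)) y = (size ts + c)%:R^-1 *: add_branch v ts y.
Proof. by rewrite /star /tree qlift_pi /= flift_gen. Qed.

Lemma star_bilinear :
  bilinear_for (GRing.Scale.Law.clone _ _ *:%R _)
               (GRing.Scale.Law.clone _ _ *:%R _) star.
Proof.
split=> [y a x x'|x a y y']; first exact: linearP.
rewrite /star -(qrepK x) !qlift_pi /= -fliftP; apply: eq_flift => -[v ts] /=.
by rewrite linearP scalerDr !scalerA [_^-1 * a]mulrC.
Qed.

HB.instance Definition _ := bilinear_isBilinear.Build K (RT V) (RT V) (RT V)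
  *:%R *:%R star star_bilinear.

Definition graft_root : tensor (RT V) (RT V) -> RT V := tlift star.

HB.instance Definition _ := GRing.Linear.on graft_root.

Lemma graft_root_tens x y : graft_root (tens x y) = star x y.
Proof. exact: tlift_tens. Qed.

End Weight.

Lemma RT_deltaE v (ts : seq (rtree V)) : RT_delta (tree (B v ts)) =
  \sum_(t <- ts) tens (tree (B v (rem t ts))) (tree t).
Proof.
rewrite RT_delta_tree.
rewrite (sum_picks (F := fun t us => tens (tree (B v us)) (tree t))) //.
by move=> t us us' /tree_perm ->.
Qed.

Lemma RT_delta_add_branch v (ts : seq (rtree V)) y :
  RT_delta (add_branch v ts y) = tens (tree (B v ts)) y +
    \sum_(t <- ts) tens (add_branch v (rem t ts) y) (tree t).
Proof.
elim/RT_ind: y => [|a u y IH].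
  by rewrite !linear0 linear0r add0r big1 // => t _; rewrite linear0 linear0l.
rewrite !linearP /= IH linearPr.
under [in RHS]eq_bigr do rewrite linearP linearPl.
rewrite big_split /= -scaler_sumr [RHS]addrACA -scalerDr; congr (_ *: _ + _).
rewrite add_branch_tree RT_delta_tree /= big_cons big_map /=; congr (_ + _).
rewrite (sum_picks (F := fun t us => tens (tree (B v (u :: us))) (tree t))).
  by apply: eq_bigr => t _; rewrite add_branch_tree.
move=> t us us' uu'; rewrite (@tree_perm _ _ _ _ (u :: us')) //.
by rewrite perm_cons.
Qed.

(** Each of the n branches is cut and grafted back onto a root with n - 1 branches, with weight 1/n;
    characteristic 0 makes n invertible. *)
Lemma graft_root_delta v (ts : seq (rtree V)) : ts != [::] ->
  graft_root 1 (RT_delta (tree (B v ts))) = tree (B v ts).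
Proof.
rewrite -size_eq0 RT_deltaE linear_sum big_seq => ts0.
rewrite (eq_bigr (fun=> (size ts)%:R^-1 *: tree (B v ts))) => [|u uts].
  rewrite -big_seq big_const_seq count_predT iter_addr_0 -scaler_nat scalerA.
  by rewrite mulfV ?(pcharf0P K).1 // scale1r.
rewrite /= graft_root_tens star_treel add_branch_tree.
rewrite size_rem // addn1 prednK ?lt0n //; congr (_ *: _); apply: tree_perm.
by rewrite perm_sym perm_to_rem.
Qed.

Lemma graft_root_delta_leaf v :
  graft_root 1 (RT_delta (tree (B (v : V) [::]))) = 0.
Proof. by rewrite RT_delta_tree big_nil linear0. Qed.

(* For u = B(v, T_1, .., T_n) (x) T, both second terms carry the weight
   1/(n + 1), as removing a branch from the first factor lowers n by one. *)
Lemma delta_graft_root (u : tensor (RT V) (RT V)) du :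
  tmap (@RT_delta K V) idfun u = du ->
  RT_delta (graft_root 1 u) + tmap (graft_root 2) idfun du =
    u + tmap (graft_root 2) idfun (tau23 du).
Proof.
pose l : {linear _ -> tensor (RT V) (RT V)} :=
  (@RT_delta K V \o graft_root 1) \+
  (tmap (graft_root 2) idfun \o tmap (@RT_delta K V) idfun).
pose r : {linear _ -> tensor (RT V) (RT V)} := idfun \+
  ((tmap (graft_root 2) idfun \o @tau23 K (RT V)) \o
    tmap (@RT_delta K V) idfun).
move=> <-; rewrite -[LHS]/(l u) -[RHS]/(r u); apply: tensor_ext => x y.
rewrite -[LHS]/((l \o applyr (@tens K _ _) y) x).
rewrite -[RHS]/((r \o applyr (@tens K _ _) y) x).
apply: RT_ext => -[v ts]; rewrite /l /r /=.
rewrite graft_root_tens star_treel linearZ /= RT_delta_add_branch addn1.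
rewrite tmap_tens /= RT_deltaE.
have -> : tens (\sum_(t <- ts) tens (tree (B v (rem t ts))) (tree t)) y =
    \sum_(t <- ts) tens (tens (tree (B v (rem t ts))) (tree t)) y.
  exact: (linear_sum (applyr (@tens K _ _) y)).
(* The term that cuts [y] and the n terms grafted back all have weight 1/(n + 1) and sum to
   [tens (tree (B v ts)) y]; the other terms agree one by one. *)
rewrite !linear_sum /= scalerDr scaler_sumr addrAC; congr (_ + _).
  rewrite big_seq
    (eq_bigr (fun=> (size ts).+1%:R^-1 *: tens (tree (B v ts)) y)).
    rewrite -big_seq big_const_seq count_predT iter_addr_0 -scaler_nat scalerA.
    rewrite -scalerDl -{1}[_^-1]mul1r -mulrDl -natr1 addrC mulfV ?scale1r //.
    by rewrite natr1 (pcharf0P K).1.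
  move=> t tts; rewrite tmap_tens /= graft_root_tens star_treel add_branch_tree.
  rewrite linearZl_LR size_rem // addn2 prednK; last by case: (ts) tts.
  congr (_ *: tens _ _); apply: tree_perm.
  by rewrite perm_sym perm_to_rem.
rewrite big_seq [RHS]big_seq; apply: eq_bigr => t tts.
rewrite tau23_tens tmap_tens /= graft_root_tens star_treel.
rewrite linearZl_LR size_rem // addn2 prednK //.
by case: (ts) tts.
Qed.

End Star.

Lemma tmap_comp (K : fieldType) (V V' V'' W W' W'' : lmodType K)
    (f : {linear V' -> V''}) (f' : {linear V -> V'})
    (g : {linear W' -> W''}) (g' : {linear W -> W'}) t :
  tmap f g (tmap f' g' t) = tmap (f \o f') (g \o g') t.
Proof.
apply: (tensor_ext (f := tmap f g \o tmap f' g')) => v w /=.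
by rewrite !tmap_tens.
Qed.

Lemma tmapK (K : fieldType) (V V' W W' : lmodType K)
    (f : {linear V -> V'}) (f' : {linear V' -> V})
    (g : {linear W -> W'}) (g' : {linear W' -> W}) :
  cancel f f' -> cancel g g' -> cancel (tmap f g) (tmap f' g').
Proof.
move=> fK gK; apply: (tensor_ext (f := tmap f' g' \o tmap f g) (g := idfun)).
by move=> v w; rewrite /= !tmap_tens fK gK.
Qed.

Lemma eq_tmap (K : fieldType) (V V' W W' : lmodType K)
    (f f' : {linear V -> V'}) (g g' : {linear W -> W'}) :
  f =1 f' -> g =1 g' -> tmap f g =1 tmap f' g'.
Proof.
by move=> ff' gg'; apply: tensor_ext => v w; rewrite /= !tmap_tens ff' gg'.
Qed.

(** * Injectivity, by induction on the number of vertices *)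

Section Vertices.
Variables (I : choiceType).

Fixpoint nverts (t : rtree I) : nat :=
  let: B v ts := t in (sumn (map nverts ts)).+1.

Lemma nverts_rem v t (ts : seq (rtree I)) : t \in ts ->
  ((nverts t < nverts (B v ts)) &&
   (nverts (B v (rem t ts)) < nverts (B v ts)))%N.
Proof.
move=> tts; rewrite /= (perm_sumn (perm_map nverts (perm_to_rem tts))) /=.
by case: t {tts} => w us /=; lia.
Qed.

End Vertices.

Section Leaf.
Variables (K : fieldType) (V : lmodType K).

Definition leaf (v : V) : RT V := tree (B v [::]).

Lemma leaf_linear : linear leaf.
Proof. by move=> a v w; rewrite /leaf tree_label. Qed.

HB.instance Definition _ := GRing.isLinear.Build K V (RT V) *:%R
  leaf leaf_linear.

End Leaf.

Section Injectivity.
Variables (K : fieldType) (L V : lmodType K).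
Hypothesis charK0 : [pchar K] =i pred0.
Variables (D : {linear L -> tensor L L}) (f : {linear RT V -> L}).
Hypothesis f_coalg : forall x, D (f x) = tmap f f (RT_delta x).
Hypothesis f_leaf : injective (f \o @leaf K V).

(** The factors of the coproduct of a tree are smaller, so the previous [g] inverts [f] on them and
    [graft_root] reassembles the tree. *)
Lemma truncated_left_inverse n : exists g : {linear L -> RT V},
  forall t, (nverts t <= n)%N -> g (f (tree t)) = tree t.
Proof.
have [p pK] := linear_left_inverse f_leaf.
(* Every tree has a vertex, so the zero map serves for [n = 0]. *)
elim: n => [|n [g gK]]; first by exists \0 => -[].
pose w : {linear L -> RT V} := graft_root 1 \o (tmap g g \o D).
(* On a tree with an edge [w] already succeeds and the correction vanishes; on a single vertex [w]
   gives 0 and [p] recovers the label. *)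
exists (w \+ (@leaf K V \o (p \o (idfun \- (f \o w))))) => -[v ts] tn.
have wE : w (f (tree (B v ts))) = graft_root 1 (RT_delta (tree (B v ts))).
  rewrite /w /= f_coalg RT_deltaE !linear_sum /= big_seq [RHS]big_seq.
  apply: eq_bigr => t /(nverts_rem v)/andP[tlt rlt].
  by rewrite !tmap_tens /= !gK // -ltnS; apply: leq_trans tn.
rewrite -[LHS]/(w (f (tree _)) + leaf (p (f (tree _) - f (w (f (tree _)))))) wE.
case: ts => [|t ts] in tn wE *.
  by rewrite graft_root_delta_leaf linear0 subr0 add0r -[tree _]/(leaf v) pK.
by rewrite graft_root_delta // subrr !linear0 addr0.
Qed.

Lemma coalgebra_morphism_injective : injective f.
Proof.
move=> x y /eqP; rewrite -subr_eq0 -linearB => /eqP fxy; apply/eqP.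
rewrite -subr_eq0; move: (x - y) fxy => z fz.
(* An element involves finitely many trees, so one size bound serves for all of them. *)
have [n nP] : exists n, forall g : {linear L -> RT V},
    (forall t, (nverts t <= n)%N -> g (f (tree t)) = tree t) -> g (f z) = z.
  elim/RT_ind: z {fz} => [|a t z [n nP]].
    by exists 0 => g _; rewrite !linear0.
  exists (maxn n (nverts t)) => g gK; rewrite !linearP /= gK ?leq_maxr //.
  by rewrite nP // => u un; rewrite gK // leq_max un.
have [g gK] := truncated_left_inverse n.
by rewrite -(nP g gK) fz linear0.
Qed.

End Injectivity.

(** * Surjectivity, by induction on the coradical degree *)

Section Surjectivity.
Variables (K : fieldType) (L : lmodType K).
Hypothesis charK0 : [pchar K] =i pred0.
Variables (D : {linear L -> tensor L L}).
Hypotheses (napD : nap_coproduct D) (connD : connected_coproduct D).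
Variables (f : {linear RT (Prim D) -> L}) (g : {linear L -> RT (Prim D)}).
Hypothesis f_coalg : forall x, D (f x) = tmap f f (RT_delta x).
Hypothesis f_leaf : forall v, f (leaf v) = prim_val v.
Hypothesis fK : cancel f g.

(** Once [du] is fixed by [tau23], [delta_graft_root] gives Delta G u = u. Then [x] and
    [f (graft_root 1 u)] have the same coproduct, so they differ by a primitive element, the image
    of a leaf. *)
Lemma coproduct_lift x u : D x = tmap f f u -> exists r, f r = x.
Proof.
move=> Dx; pose du := tmap (@RT_delta K (Prim D)) idfun u.
have duE : tmap D idfun (D x) = tmap (tmap f f) f du.
  by rewrite Dx /du !tmap_comp; apply: eq_tmap => y //=; rewrite f_coalg.
have du23 : tau23 du = du.
  (* The left inverse [g] makes the triple tensor power of [f] injective, so the permutative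
     identity of [D] descends to [du]. *)
  have ffK := tmapK (tmapK fK fK) fK.
  apply: (can_inj ffK); rewrite -tau23_natural -duE.
  by apply/esym/eqP; rewrite -subr_eq0 napD.
have := delta_graft_root charK0 (erefl du); rewrite du23 => /addIr Gu.
have xGu : x - f (graft_root 1 u) \in prim D.
  by rewrite primE linearB f_coalg Gu Dx subrr.
exists (graft_root 1 u + leaf (MkPrim xGu)).
by rewrite linearD f_leaf addrC subrK.
Qed.

Lemma coalgebra_morphism_surjective x : exists r, f r = x.
Proof.
have [n n1 xn] := connD x; elim/ltn_ind: n x xn n1 => n IH x xn n1.
have [n2|] := leqP 2 n; last first.
  case: n n1 xn {IH} => [|[|]] // _ /cfilt1 Dx _.
  by apply: (coproduct_lift (u := 0)); rewrite linear0.
suff [u] : exists u, D x = tmap f f u by apply: coproduct_lift.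
move/cfiltS: xn => /(_ n2).
(* Both factors of each generating tensor have degree below [n], hence lie in the image of [f]. *)
elim=> [|c _ t [i [a [b [lein Fa Fb ->]]]] _ [u ->]].
  by exists 0; rewrite linear0.
have [r <-] : exists r, f r = a by apply: (IH i) => //; lia.
have [s <-] : exists s, f s = b by apply: (IH (n - i)%N) => //; lia.
by exists (c *: tens r s + u); rewrite linearP /= tmap_tens.
Qed.

End Surjectivity.

Theorem theorem3p4 (K : fieldType) (charK0 : [pchar K] =i pred0)
    (H : lmodType K)
    (circH : {bilinear H -> H -> H}) (deltaH : {linear H -> tensor H H})
    (prelieH : prelie_identity circH)
    (napH : nap_coproduct deltaH)
    (connectedH : connected_coproduct deltaH)
    (compatH : forall a b : H,
      deltaH (circH a b) = tens a b + tact circH (deltaH a) b) :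
  exists phi : {linear H -> RT (Prim deltaH)},
    [/\ bijective phi,
        forall a b : H, phi (circH a b) = RT_circ (phi a) (phi b)
      & forall a : H, RT_delta (phi a) = tmap phi phi (deltaH a)].
Proof.
pose i : {linear Prim deltaH -> H} := (val : Prim deltaH -> H).
pose f : {linear RT (Prim deltaH) -> H} := realize i prelieH.
have prim_i v : deltaH (i v) = 0.
  by apply/eqP; rewrite -primE; apply: valP.
have f_coalg x : deltaH (f x) = tmap f f (RT_delta x).
  exact: realize_coproduct.
have f_leaf v : f (leaf v) = prim_val v.
  by rewrite /f /= realize_tree /= brace_nil.
have f_inj : injective f.
  apply: (coalgebra_morphism_injective charK0 f_coalg) => v w /=.
  by rewrite !f_leaf => /val_inj.
(* This [g] is the isomorphism sought: surjectivity of [f] makes it a two-sided inverse, and both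
   compatibilities transport from [f]. *)
have [g fK] := linear_left_inverse f_inj.
have gK : cancel g f.
  move=> x; have [r <-] := coalgebra_morphism_surjective charK0 napH connectedH
    f_coalg f_leaf fK x.
  by rewrite fK.
exists g; split; first by exists f.
- move=> a b; rewrite -{1}(gK a) -{1}(gK b).
  rewrite -[circH _ _](realize_circ i prelieH).
  exact: fK.
- by move=> a; rewrite -{2}(gK a) f_coalg (tmapK fK fK).
Qed.
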